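(* Let $G=(V,E)$ be a graph, let $x\in\mathbb{R}$ with $x>-\frac14$ and $x\neq 0$, and let $S$ be a finite multiset of nonnegative integers such that $\lambda_1^{s+2}\neq\lambda_2^{s+2}$ for all $s\in S$, where $\lambda_{1,2}=\frac12\pm\sqrt{\frac14+x}$ are the two roots of $\lambda^2-\lambda-x$. Then \[ I(G_S;x)=\Big(\prod_{s\in S}C_s\Big)^{|V|}\, I(G;x(S)), \] where \[ x(S)+1=\prod_{s\in S}\Big(1+\frac{B_s}{C_s}\Big),\qquad B_k=\frac{x}{\lambda_2-\lambda_1}\big(\lambda_2^{k+1}-\lambda_1^{k+1}\big),\qquad C_k=\frac{1}{\lambda_2-\lambda_1}\big(\lambda_2^{k+2}-\lambda_1^{k+2}\big). \]
   Context: For a graph $H=(W,F)$ and a number $y$, $I(H;y)=\sum_{A\subseteq W,\,A\text{ independent}} y^{|A|}$, where $A$ is independent if no two vertices of $A$ are adjacent. For a finite multiset $S=\{s_1,\dots,s_\ell\}$ of nonnegative integers, the $S$-clone $G_S$ of $G=(V,E)$ is the graph defined as follows: for each vertex $a\in V$ there are $\ell$ vertices $a_1,\dots,a_\ell$ in $G_S$; for each edge $uv\in E$, every vertex $u_i$ is joined to every vertex $v_j$ ($1\le i,j\le \ell$); for each $a\in V$ and each $i$, $1\le i\le\ell$, there are $s_i$ further new vertices $a_{i,1},\dots,a_{i,s_i}$ and edges $a_ia_{i,1},a_{i,1}a_{i,2},\dots,a_{i,s_i-1}a_{i,s_i}$ (a path of length $s_i$ attached at $a_i$); there are no other vertices or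 edges. *)

(* Defs.v *)
From HB Require Import structures.
From mathcomp Require Import all_boot all_order all_algebra.
From mathcomp Require Import reals.
Set Implicit Arguments.
Unset Strict Implicit.
Unset Printing Implicit Defensive.
Import Order.TTheory GRing.Theory Num.Theory.
Local Open Scope ring_scope.

Record graph := Graph {
  vertex :> finType;
  adj : rel vertex;
  adj_sym : symmetric adj;
  adj_irrefl : irreflexive adj }.

Definition independent (H : graph) (A : {set H}) : bool :=
  [forall u in A, forall v in A, ~~ adj u v].

Definition indep_poly (R : realType) (H : graph) (y : R) : R :=
  \sum_(A : {set H} | independent A) y ^+ #|A|.

Section Clone.
Variables (G : graph) (S : seq nat).

(* A finite multiset is given by any listing S = [:: s_1; ...; s_l]; indices  *)
(* are shifted to start at 0. The vertex (a, Tagged _ k) with tag i stands    *)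
(* for a_i when k = 0 and for the path vertex a_{i,k} when 1 <= k <= s_i.     *)
Definition clone_vertex : finType :=
  (vertex G * {i : 'I_(size S) & 'I_(nth 0%N S i).+1})%type.

Definition clone_base (p : clone_vertex) : G := p.1.
Definition clone_copy (p : clone_vertex) : 'I_(size S) := tag p.2.
Definition clone_pos (p : clone_vertex) : nat := tagged p.2.

Definition clone_adj : rel clone_vertex := fun p q =>
  [&& clone_pos p == 0%N, clone_pos q == 0%N
    & adj (clone_base p) (clone_base q)]
  || [&& clone_base p == clone_base q, clone_copy p == clone_copy q
    & (clone_pos q == (clone_pos p).+1) || (clone_pos p == (clone_pos q).+1)].

Lemma clone_adj_sym : symmetric clone_adj.
Proof.
move=> p q; rewrite /clone_adj adj_sym (eq_sym (clone_base p)).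
by rewrite (eq_sym (clone_copy p)) andbCA
  [(clone_pos q == _) || _]orbC.
Qed.

Lemma clone_adj_irrefl : irreflexive clone_adj.
Proof.
by move=> p; rewrite /clone_adj adj_irrefl !andbF !eqxx orbb ltn_eqF.
Qed.

Definition clone : graph := Graph clone_adj_sym clone_adj_irrefl.

End Clone.

Section Coefficients.
Variables (R : realType) (x : R).

Definition lambda1 : R := 1 / 2 + Num.sqrt (1 / 4 + x).
Definition lambda2 : R := 1 / 2 - Num.sqrt (1 / 4 + x).

Definition Bcoef (k : nat) : R :=
  x / (lambda2 - lambda1) * (lambda2 ^+ (k + 1) - lambda1 ^+ (k + 1)).

Definition Ccoef (k : nat) : R :=
  1 / (lambda2 - lambda1) * (lambda2 ^+ (k + 2) - lambda1 ^+ (k + 2)).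

Definition clone_point (S : seq nat) : R :=
  \prod_(s <- S) (1 + Bcoef s / Ccoef s) - 1.

End Coefficients.

(* Main.v *)
(* An independent set of the clone restricts, above each vertex of [G], to an
   independent set of a disjoint union of paths, one for each [s] in [S], and
   two vertices of [G] interact only through the ends [a_i] of these paths.
   So the sum over the independent sets factors over the vertices of [G]: a
   vertex contributes [p - q] if one of the ends above it is selected and [q]
   otherwise, where [p] and [q] are the weights of its union of paths with and
   without the ends.  Deleting an end vertex of a path shows that the path with
   [n] vertices has weight [C_n], by [C_(n + 1) = C_n + B_n] and
   [B_(n + 1) = x * C_n], hence [p = \prod_s (C_s + B_s)] and
   [q = \prod_s C_s]. *)
Require Import Defs.
From mathcomp Require Import all_boot all_order all_algebra.
From mathcomp Require Import reals ring lra zify.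
Set Implicit Arguments.
Unset Strict Implicit.
Unset Printing Implicit Defensive.
Import Order.TTheory GRing.Theory Num.Theory.
Local Open Scope ring_scope.

Local Notation fiber h i := [set t | h t == i].

Lemma mem_imset_fiber (T I : finType) (h : T -> I) (A : {set T}) i :
  (i \in h @: A) = (A :&: fiber h i != set0).
Proof.
apply/imsetP/set0Pn => [[t tA ->]|[t]]; first by exists t; rewrite !inE tA /=.
by rewrite !inE => /andP[tA /eqP <-]; exists t.
Qed.

Lemma card_fibers (T I : finType) (h : T -> I) (A : {set T}) :
  #|A| = (\sum_i #|A :&: fiber h i|)%N.
Proof.
rewrite -sum1_card (partition_big h xpredT) //=; apply: eq_bigr => i _.
by rewrite sum1dep_card; apply: eq_card => t; rewrite !inE.
Qed.

Lemma sum_set_fibers (R : comPzSemiRingType) (T I : finType) (h : T -> I)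
    (P : I -> pred {set T}) (x : R) :
  \sum_(A : {set T} | [forall i, P i (A :&: fiber h i)]) x ^+ #|A| =
  \prod_i \sum_(B : {set T} | (B \subset fiber h i) && P i B) x ^+ #|B|.
Proof.
rewrite bigA_distr_big_dep.
rewrite [RHS](reindex_onto
  (fun A : {set T} => [ffun i => A :&: fiber h i])
  (fun f : {ffun I -> {set T}} => [set t | t \in f (h t)])) /=; last first.
  move=> f /familyP fP; apply/ffunP => i; rewrite ffunE.
  have /andP[/subsetP f_sub _] := fP i.
  apply/setP => t; rewrite !inE; apply/andP/idP => [[+ /eqP <-] //|t_f].
  by have := f_sub t t_f; rewrite inE => /eqP ->.
apply: eq_big => [A|A _]; last first.
  rewrite (card_fibers h A) -prodrXr.
  by apply: eq_bigr => i _; rewrite ffunE.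
have -> : [set t | t \in [ffun i => A :&: fiber h i] (h t)] = A.
  by apply/setP => t; rewrite inE ffunE !inE eqxx andbT.
rewrite eqxx andbT; apply/forallP/familyP => AP i; have := AP i.
  by rewrite ffunE unfold_in subsetIr.
by rewrite ffunE unfold_in => /andP[].
Qed.

Lemma imset_setD (aT rT : finType) (f : aT -> rT) (A : {set aT})
    (B : {set rT}) :
  f @: A :\: B = f @: (A :\: f @^-1: B).
Proof.
apply/setP => y; rewrite inE; apply/andP/imsetP => [[yB /imsetP[a aA y_a]]|].
  by exists a; rewrite // !inE aA -y_a yB.
by case=> a; rewrite !inE => /andP[aB aA] ->; rewrite aB imset_f.
Qed.

Definition neighbors (H : graph) (v : H) : {set H} := [set u | adj v u].

Lemma independentP (H : graph) (A : {set H}) :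
  reflect {in A &, forall u v, ~~ adj u v} (independent A).
Proof.
apply: (iffP forall_inP) => [indA u v uA|indA u uA].
  exact: (forall_inP (indA u uA)).
by apply/forall_inP => v; apply: indA.
Qed.

Lemma independentS (H : graph) (A B : {set H}) :
  A \subset B -> independent B -> independent A.
Proof.
move=> /subsetP AB /independentP indB; apply/independentP => u v uA vA.
by rewrite indB ?AB.
Qed.

Lemma independent0 (H : graph) : independent (set0 : {set H}).
Proof. by apply/independentP => u v; rewrite inE. Qed.

Lemma independentU1 (H : graph) (v : H) (A : {set H}) :
  independent (v |: A) = independent A && [disjoint A & neighbors v].
Proof.
apply/idP/andP => [ind_vA|[/independentP indA disjA]].
  split; first by apply: independentS ind_vA; apply: subsetUr.
  rewrite disjoints_subset; apply/subsetP => u uA; rewrite !inE.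
  by apply: (independentP _ ind_vA); rewrite ?setU11 ?setU1r.
have not_adj u : u \in A -> ~~ adj v u.
  by move=> uA; have := disjointFr disjA uA; rewrite inE => ->.
apply/independentP => u w /setU1P[->|uA] /setU1P[->|wA].
- by rewrite adj_irrefl.
- exact: not_adj.
- by rewrite adj_sym not_adj.
- exact: indA.
Qed.

Definition indep_sum (R : comPzSemiRingType) (H : graph) (x : R)
    (W : {set H}) : R :=
  \sum_(A : {set H} | (A \subset W) && independent A) x ^+ #|A|.

Lemma indep_polyE (R : realType) (H : graph) (x : R) :
  indep_poly H x = indep_sum x [set: H].
Proof. by apply: eq_bigl => A; rewrite subsetT. Qed.

Section IndepSum.
Variables (R : comPzSemiRingType) (H : graph) (x : R).
Implicit Types (v : H) (W : {set H}).

Lemma indep_sum0 : indep_sum x (set0 : {set H}) = 1.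
Proof.
rewrite /indep_sum (big_pred1 set0) ?cards0 // => A /=; rewrite subset0.
by case: eqP => // ->; rewrite independent0.
Qed.

Lemma indep_sum_delete v W : v \in W ->
  indep_sum x W =
  indep_sum x (W :\ v) + x * indep_sum x (W :\: (v |: neighbors v)).
Proof.
move=> vW; rewrite /indep_sum (bigID (fun A : {set H} => v \notin A)) /=.
congr (_ + _); first by apply: eq_bigl => A; rewrite subsetD1 andbAC.
rewrite (reindex_onto (fun A => v |: A) (fun A => A :\ v)) /=; last first.
  by move=> A /andP[_]; rewrite negbK => /setD1K.
rewrite mulr_sumr; apply: eq_big => [A|A /andP[_ /eqP vA]]; last first.
  by rewrite cardsU1 -vA setD11 add1n exprS vA.
have -> : ((v |: A) :\ v == A) = (v \notin A).
  by apply/eqP/idP => [<-|/setU1K //]; rewrite setD11.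
rewrite setU11 andbT subUset sub1set vW independentU1 -setDDl subsetD subsetD1.
by rewrite -!andbA; do !bool_congr.
Qed.

Lemma indep_sum_disjoint W (Z : {set H}) :
  \sum_(A : {set H} | (A \subset W) && independent A && [disjoint A & Z])
    x ^+ #|A| = indep_sum x (W :\: Z).
Proof. by apply: eq_bigl => A; rewrite subsetD andbAC. Qed.

Lemma indep_sum_fibers (I : finType) (h : H -> I) W :
  {in W &, forall u v, adj u v -> h u = h v} ->
  indep_sum x W = \prod_i indep_sum x (W :&: fiber h i).
Proof.
move=> adj_fiber.
have split_fibers (A : {set H}) : (A \subset W) && independent A =
    [forall i, (A :&: fiber h i \subset W) && independent (A :&: fiber h i)].
  apply/andP/forallP => [[AW indA] i|indA].
    by rewrite (subset_trans (subsetIl _ _) AW)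
      (independentS (subsetIl _ _) indA).
  have AW : A \subset W.
    apply/subsetP => u uA; have /andP[/subsetP + _] := indA (h u); apply.
    by rewrite !inE uA eqxx.
  split=> //; apply/independentP => u v uA vA; apply/negP => adj_uv.
  have huv := adj_fiber u v (subsetP AW u uA) (subsetP AW v vA) adj_uv.
  have /andP[_ /independentP/(_ u v)] := indA (h v).
  by rewrite !inE uA vA huv eqxx adj_uv => /(_ isT isT).
rewrite /indep_sum (eq_bigl _ _ split_fibers).
rewrite (sum_set_fibers h (fun i B => (B \subset W) && independent B)) /=.
apply: eq_bigr => i _; apply: eq_bigl => A.
by rewrite subsetI andbA [(_ \subset W) && _]andbC.
Qed.

End IndepSum.

Lemma indep_sum_meet (R : comPzRingType) (H : graph) (x : R) (W Z : {set H}) :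
  \sum_(A : {set H} | (A \subset W) && independent A && ~~ [disjoint A & Z])
    x ^+ #|A| = indep_sum x W - indep_sum x (W :\: Z).
Proof.
rewrite -indep_sum_disjoint {1}/indep_sum.
rewrite [X in X - _](bigID (fun A : {set H} => [disjoint A & Z])) /=.
by rewrite addrAC subrr add0r.
Qed.

Section BlowUp.
Variables (H G : graph) (h : H -> G) (Z : {set H}).
Hypothesis adj_link : forall u v,
  h u != h v -> adj u v = [&& u \in Z, v \in Z & adj (h u) (h v)].

Lemma independent_blowup (A : {set H}) :
  independent A =
  [forall a, independent (A :&: fiber h a)] && independent (h @: (A :&: Z)).
Proof.
apply/idP/andP => [indA|[/forallP ind_fiber /independentP ind_base]].
  split; first by apply/forallP => a; apply: independentS indA; apply: subsetIl.
  apply/independentP => _ _ /imsetP[u + ->] /imsetP[v + ->].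
  rewrite !inE => /andP[uA uZ] /andP[vA vZ]; apply/negP => adj_huv.
  have huv : h u != h v by apply: contraTneq adj_huv => ->; rewrite adj_irrefl.
  by have := independentP _ indA u v uA vA; rewrite adj_link // uZ vZ adj_huv.
apply/independentP => u v uA vA; have [huv|huv] := eqVneq (h u) (h v).
  by apply: (independentP _ (ind_fiber (h v))); rewrite !inE ?uA ?vA ?huv eqxx.
rewrite adj_link //; apply/and3P => -[uZ vZ]; apply/negP.
by apply: ind_base; rewrite imset_f // inE ?uA ?vA.
Qed.

Variables (R : comPzRingType) (x : R).

Lemma indep_sum_blowup :
  indep_sum x [set: H] =
  \sum_(D : {set G} | independent D) \prod_a
    (if a \in D then indep_sum x (fiber h a) - indep_sum x (fiber h a :\: Z)
     else indep_sum x (fiber h a :\: Z)).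
Proof.
rewrite /indep_sum (partition_big (fun A : {set H} => h @: (A :&: Z))
  (@independent G)) /=; last first.
  by move=> A; rewrite independent_blowup => /and3P[].
apply: eq_bigr => D indD.
transitivity (\prod_a \sum_(B : {set H} | (B \subset fiber h a) &&
    (independent B && (~~ [disjoint B & Z] == (a \in D)))) x ^+ #|B|).
  rewrite -(sum_set_fibers h (fun a B =>
    independent B && (~~ [disjoint B & Z] == (a \in D)))).
  apply: eq_bigl => A; rewrite subsetT independent_blowup /=.
  have linked a : ~~ [disjoint A :&: fiber h a & Z] = (a \in h @: (A :&: Z)).
    by rewrite mem_imset_fiber -setI_eq0 setIAC.
  apply/idP/forallP => [/andP[/andP[/forallP indA _] /eqP <-] a|indA].
    by rewrite indA linked eqxx.
  have -> : h @: (A :&: Z) = D.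
    by apply/setP => a; rewrite -linked; have /andP[_ /eqP] := indA a.
  rewrite indD eqxx !andbT; apply/forallP => a.
  by have /andP[] := indA a.
apply: eq_bigr => a _; case: (a \in D).
  rewrite -indep_sum_meet; apply: eq_bigl => B.
  by rewrite eqb_id andbA.
rewrite -/(indep_sum _ _) -indep_sum_disjoint; apply: eq_bigl => B.
by rewrite eqbF_neg negbK andbA.
Qed.

Lemma indep_sum_uniform_blowup (q y : R) :
  (forall a, indep_sum x (fiber h a) = q * (1 + y)) ->
  (forall a, indep_sum x (fiber h a :\: Z) = q) ->
  indep_sum x [set: H] = q ^+ #|G| * indep_sum y [set: G].
Proof.
move=> fiberE unlinkedE.
rewrite indep_sum_blowup [indep_sum y _]/indep_sum mulr_sumr.
apply: eq_big => [D|D _]; first by rewrite subsetT.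
rewrite -[q ^+ _]prodr_const -[y ^+ _]prodr_const.
rewrite [X in _ * X]big_mkcond -big_split /=; apply: eq_bigr => a _.
rewrite fiberE unlinkedE mulrDr mulr1 addrC addKr.
by case: (a \in D); rewrite ?mulr1.
Qed.

End BlowUp.

Definition induced_path (H : graph) n (f : 'I_n -> H) : Prop :=
  injective f /\
  forall i j, adj (f i) (f j) = (j == i.+1 :> nat) || (i == j.+1 :> nat).

Definition path_tail (H : graph) n (f : 'I_n -> H) (m : nat) : {set H} :=
  f @: [set k : 'I_n | (m <= k)%N].

Lemma path_tail_eq0 (H : graph) n (f : 'I_n -> H) m :
  (n <= m)%N -> path_tail f m = set0.
Proof.
move=> nm; rewrite /path_tail.
suff -> : [set k : 'I_n | (m <= k)%N] = set0 by rewrite imset0.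
by apply/setP => k; rewrite !inE; have := ltn_ord k; lia.
Qed.

Lemma indep_sum_path_tail_rec (R : comPzSemiRingType) (H : graph) n
    (f : 'I_n -> H) (x : R) m :
  induced_path f -> (m < n)%N ->
  indep_sum x (path_tail f m) =
  indep_sum x (path_tail f m.+1) + x * indep_sum x (path_tail f m.+2).
Proof.
move=> [f_inj f_adj] mn; pose k0 := Ordinal mn.
rewrite (@indep_sum_delete _ _ _ (f k0)); last by rewrite imset_f ?inE /=.
rewrite !imset_setD.
have -> : [set k : 'I_n | (m <= k)%N] :\: f @^-1: [set f k0] =
    [set k : 'I_n | (m < k)%N].
  by apply/setP => k; rewrite !inE (inj_eq f_inj) -val_eqE /=; lia.
suff -> : [set k : 'I_n | (m <= k)%N] :\: f @^-1: (f k0 |: neighbors (f k0)) =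
    [set k : 'I_n | (m.+1 < k)%N] by [].
by apply/setP => k; rewrite !inE (inj_eq f_inj) f_adj -val_eqE /=; lia.
Qed.

Section Coefficients.
Variables (R : realType) (x : R).
Hypothesis x_gt : - (1 / 4) < x.

Lemma lambda_subr_neq0 : lambda2 x - lambda1 x != 0.
Proof.
have : 0 < Num.sqrt (1 / 4 + x) by rewrite sqrtr_gt0; have := x_gt; lra.
by rewrite /lambda1 /lambda2 => sqrt_gt0; rewrite lt_eqF //; lra.
Qed.

Lemma sqr_sqrt_discriminant : Num.sqrt (1 / 4 + x) ^+ 2 = 1 / 4 + x.
Proof. by rewrite sqr_sqrtr //; have := x_gt; lra. Qed.

Lemma lambda1_sqr : lambda1 x ^+ 2 = lambda1 x + x.
Proof. by rewrite /lambda1 sqrrD sqr_sqrt_discriminant; field. Qed.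

Lemma lambda2_sqr : lambda2 x ^+ 2 = lambda2 x + x.
Proof. by rewrite /lambda2 sqrrB sqr_sqrt_discriminant; field. Qed.

Lemma Bcoef0 : Bcoef x 0 = x.
Proof. by rewrite /Bcoef !expr1 divfK ?lambda_subr_neq0. Qed.

Lemma Ccoef0 : Ccoef x 0 = 1.
Proof.
rewrite /Ccoef !add0n lambda1_sqr lambda2_sqr; field.
exact: lambda_subr_neq0.
Qed.

Lemma BcoefS k : Bcoef x k.+1 = x * Ccoef x k.
Proof. by rewrite /Bcoef /Ccoef addSnnS; ring. Qed.

Lemma CcoefS k : Ccoef x k.+1 = Ccoef x k + Bcoef x k.
Proof.
have power_rec l : l ^+ 2 = l + x ->
    l ^+ (k.+1 + 2) = l ^+ (k + 2) + x * l ^+ (k + 1).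
  by move=> l_sqr; rewrite addSnnS !exprD expr1 exprS l_sqr; ring: l_sqr.
by rewrite /Ccoef /Bcoef (power_rec _ lambda1_sqr) (power_rec _ lambda2_sqr);
  ring.
Qed.

Lemma Ccoef_neq0 k :
  lambda1 x ^+ (k + 2) <> lambda2 x ^+ (k + 2) -> Ccoef x k != 0.
Proof.
move=> /eqP lk; rewrite /Ccoef mulf_neq0 ?mul1r ?invr_eq0 ?lambda_subr_neq0 //.
by rewrite subr_eq0 eq_sym.
Qed.

(* For [n <= m] both sides are 1: the tail is empty and [n - m] truncates to 0. *)
Lemma indep_sum_path_tail (H : graph) n (f : 'I_n -> H) m :
  induced_path f -> indep_sum x (path_tail f m) = Ccoef x (n - m).
Proof.
move=> f_path.
suff tailsE d j : (n - j)%N = d ->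
    indep_sum x (path_tail f j) = Ccoef x d /\
    x * indep_sum x (path_tail f j.+1) = Bcoef x d.
  by have [] := tailsE _ m erefl.
elim: d j => [|d IHd] j nj.
  by rewrite !path_tail_eq0 ?indep_sum0 ?Ccoef0 ?Bcoef0 ?mulr1 //; lia.
have [|C_d B_d] := IHd j.+1; first by lia.
rewrite (indep_sum_path_tail_rec _ f_path); last by lia.
by rewrite C_d B_d -CcoefS -BcoefS.
Qed.

End Coefficients.

Section Clone.
Variables (G : graph) (S : seq nat).

Definition clone_leg (a : G) (i : 'I_(size S)) (k : 'I_(nth 0%N S i).+1) :
  clone G S := (a, Tagged (fun i : 'I_(size S) => 'I_(nth 0%N S i).+1) k).

Definition clone_roots : {set clone G S} := [set p | clone_pos p == 0%N].

Lemma clone_leg_path a i : induced_path (@clone_leg a i).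
Proof.
split=> [k l [] /eqP|k l]; first by rewrite eq_Tagged => /eqP.
by rewrite /= /clone_adj /clone_pos /clone_base /clone_copy /= adj_irrefl !eqxx
  !andbF.
Qed.

Lemma clone_leg_tail a i m :
  [set p : clone G S | (clone_base p == a) && (m <= clone_pos p)%N]
    :&: fiber (@clone_copy G S) i =
  path_tail (@clone_leg a i) m.
Proof.
apply/setP => p; apply/idP/imsetP => [|[k + ->]]; last first.
  by rewrite !inE /clone_base /clone_copy /clone_pos /= !eqxx => ->.
case: p => b [j k]; rewrite !inE /clone_base /clone_copy /clone_pos /=.
by case/andP=> /andP[/eqP -> mk] /eqP ji; case: i / ji; exists k; rewrite ?inE.
Qed.

Lemma clone_adj_base (p q : clone G S) :
  clone_base p != clone_base q ->
  adj p q = [&& p \in clone_roots, q \in clone_roots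
              & adj (clone_base p) (clone_base q)].
Proof. by move=> /negPf pq; rewrite /= /clone_adj pq orbF !inE. Qed.

Lemma clone_adj_copy (p q : clone G S) :
  clone_base p = clone_base q -> adj p q -> clone_copy p = clone_copy q.
Proof.
rewrite /= /clone_adj => ->; rewrite adj_irrefl !andbF /=.
by case/and3P => _ /eqP.
Qed.

Lemma indep_sum_clone_fiber (R : realType) (x : R) a m : - (1 / 4) < x ->
  indep_sum x [set p : clone G S | (clone_base p == a) && (m <= clone_pos p)%N]
  = \prod_(s <- S) Ccoef x (s.+1 - m).
Proof.
move=> x_gt; rewrite (@indep_sum_fibers _ (clone G S) _ _ (@clone_copy G S));
  last first.
  move=> p q; rewrite !inE => /andP[/eqP pa _] /andP[/eqP qa _].
  by apply: clone_adj_copy; rewrite pa qa.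
rewrite (big_nth 0%N) big_mkord; apply: eq_bigr => i _.
by rewrite clone_leg_tail (indep_sum_path_tail x_gt _ (clone_leg_path a i)).
Qed.

End Clone.

Theorem theorem3p5 (R : realType) (G : graph) (x : R) (S : seq nat)
    (hx : - (1 / 4) < x) (hx0 : x <> 0)
    (hS : forall s : nat, s \in S -> lambda1 x ^+ (s + 2) <> lambda2 x ^+ (s + 2)) :
  indep_poly (clone G S) x =
    (\prod_(s <- S) Ccoef x s) ^+ #|G| * indep_poly G (clone_point x S).
Proof.
rewrite !indep_polyE.
apply: (indep_sum_uniform_blowup (@clone_adj_base G S)) => a.
  have -> : fiber (@clone_base G S) a =
      [set p | (clone_base p == a) && (0 <= clone_pos p)%N].
    by apply/setP => p; rewrite !inE andbT.
  rewrite indep_sum_clone_fiber // /clone_point addrC subrK -big_split /=.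
  rewrite !big_seq; apply: eq_bigr => s /hS/(Ccoef_neq0 hx) Cs_neq0.
  by rewrite subn0 CcoefS // mulrDr mulr1 mulrC divfK.
have -> : fiber (@clone_base G S) a :\: clone_roots G S =
    [set p | (clone_base p == a) && (1 <= clone_pos p)%N].
  by apply/setP => p; rewrite !inE andbC lt0n.
by rewrite indep_sum_clone_fiber //; apply: eq_bigr => s _; rewrite subn1.
Qed.
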